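(* Let $(A,\mathfrak m)$ be a nonzero commutative local ring with residue field $\kappa$ and let $R=\mathcal T(A)$. For $\mathfrak p\in\mathrm{Spec}\,A$ put $P_{\mathfrak p}=\pi^{-1}(\mathfrak p)$; for $i\in\mathbb N$ put $M_i=\{(a,(c_j))\in R: c_i=0\}$; and put $M_\infty=P_{\mathfrak m}$. The prime ideals of $R$ are precisely $$\{P_{\mathfrak p}:\mathfrak p\in\mathrm{Spec}\,A\}\ \sqcup\ \{M_i:i\in\mathbb N\}$$ (a disjoint union). The first family is the closed subset $V_R(J)$ of $\mathrm{Spec}\,R$, naturally homeomorphic to $\mathrm{Spec}\,A$ (via $\mathfrak p\mapsto P_{\mathfrak p}$). Each $M_i$ is both a minimal prime and a maximal ideal, and is an isolated point of $\mathrm{Spec}\,R$. Moreover, for all $\mathfrak p\in\mathrm{Spec}\,A$ and $i\in\mathbb N$, $$R_{P_{\mathfrak p}}\cong A_{\mathfrak p},\qquad R_{M_i}\cong\kappa.$$ The maximal ideals of $R$ are $M_\infty$ and the $M_i$, $i\in\mathbb N$.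
   Context: All rings are commutative with identity. For a nonzero local ring $(A,\mathfrak m)$ (not necessarily Noetherian) with residue field $\kappa=A/\mathfrak m$ and residue map $a\mapsto\bar a$, define the ring, with coordinatewise operations, $$\mathcal T(A)=\{(a,(c_i)_{i\in\mathbb N})\in A\times\kappa^{\mathbb N}: c_i=\bar a\text{ for all but finitely many }i\},\quad \mathbb N=\{1,2,\ldots\}.$$ $\pi:\mathcal T(A)\to A$ is the surjective ring homomorphism $\pi(a,(c_i))=a$, and $J=\ker\pi$, the ideal of elements $(0,(c_i))$ with $(c_i)$ of finite support. Spectra carry the Zariski topology, and $V_R(J)$ is the set of primes of $R$ containing $J$. *)

(* Defs.v *)
From HB Require Import structures.
From mathcomp Require Import all_boot all_order all_algebra.
From mathcomp Require Import generic_quotient ring_quotient.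
From mathcomp Require Import boolp classical_sets functions cardinality filter.
From mathcomp Require Import topology.
From mathcomp Require Import ring.

Set Implicit Arguments.
Unset Strict Implicit.
Unset Printing Implicit Defensive.

Import GRing.Theory.

Local Open Scope classical_set_scope.
Local Open Scope ring_scope.
Local Open Scope quotient_scope.

(* Ideals are MathComp's [idealr] and [prime_idealr], which are boolean
   predicates (no restriction on subsets, in the presence of [boolp]) and
   proper by definition. *)

Definition maximal_ideal (R : comNzRingType) (I : idealr R) : Prop :=
  forall K : idealr R, {subset I <= K} -> {subset K <= I}.

Definition local_ring (A : comNzRingType) (m : idealr A) : Prop :=
  maximal_ideal m /\ forall n : idealr A, maximal_ideal n -> n =i m.

Definition ring_iso (R S : nzRingType) : Prop :=
  exists f : {rmorphism R -> S}, bijective f.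

Definition homeomorphism_onto (X Y : topologicalType) (f : X -> Y) (B : set Y)
    : Prop :=
  [/\ set_bij [set: X] B f, continuous f &
      exists2 g : Y -> X, cancel f g & {within B, continuous g}].

Section Comap.
Variables (R S : comNzRingType) (f : {rmorphism R -> S}).

Definition comap (I : {pred S}) : {pred R} := fun x => f x \in I.

Lemma mem_comap (I : {pred S}) x : (x \in comap I) = (f x \in I).
Proof. by []. Qed.

Lemma comap_idealr_closed (I : idealr S) : idealr_closed (comap I).
Proof.
split=> [||a x y]; rewrite !mem_comap ?rmorph0 ?rmorph1.
- exact: idealr0.
- by rewrite idealr1.
by move=> fx fy; rewrite rmorphD rmorphM rpredD ?idealMr.
Qed.

HB.instance Definition _ (I : idealr S) :=
  isIdealr.Build R (comap I) (comap_idealr_closed I).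

Lemma comap_prime_idealr_closed (I : prime_idealr S) :
  prime_idealr_closed (comap I).
Proof. by move=> x y; rewrite !mem_comap rmorphM prime_idealrM. Qed.

HB.instance Definition _ (I : prime_idealr S) :=
  isPrimeIdealrClosed.Build R (comap I) (@comap_prime_idealr_closed I).

End Comap.

Section Spectrum.
Variable R : comNzRingType.

(* A copy of [prime_idealr R]: that type lives in a universe which is too large
   for it to be the carrier of a topological space. *)
Record Spec : Type := MkSpec {
  Spec_pred : R -> bool ;
  Spec_idealr_closed : idealr_closed Spec_pred ;
  Spec_prime_closed : prime_idealr_closed Spec_pred }.

HB.instance Definition _ (p : Spec) :=
  isIdealr.Build R (Spec_pred p) (Spec_idealr_closed p).
HB.instance Definition _ (p : Spec) :=
  isPrimeIdealrClosed.Build R (Spec_pred p) (@Spec_prime_closed p).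

Definition Spec_ideal (p : Spec) : prime_idealr R :=
  Spec_pred p : prime_idealr R.

Coercion Spec_ideal : Spec >-> prime_idealr.

Lemma Spec_eqP (p q : Spec) : p =i q <-> p = q.
Proof.
split=> [|-> //]; case: p q => [p p1 p2] [q q1 q2] pq.
have {}pq : p = q by apply/funext => x; apply: pq.
by case: _ / pq in q1 q2 *; congr MkSpec; apply: Prop_irrelevance.
Qed.

HB.instance Definition _ := gen_eqMixin Spec.
HB.instance Definition _ := gen_choiceMixin Spec.

Definition zero_locus (E : set R) : set Spec :=
  [set p : Spec | forall x, E x -> x \in p].

Definition Zariski_open (U : set Spec) : Prop :=
  exists E : set R, U = ~` zero_locus E.

Lemma Zariski_openT : Zariski_open [set: Spec].
Proof.
exists [set 1]; rewrite -setC0; congr (~` _); apply/esym.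
by rewrite -subset0 => p /(_ 1 erefl); rewrite idealr1.
Qed.

Lemma Zariski_openI : setI_closed Zariski_open.
Proof.
move=> _ _ [E ->] [F ->]; rewrite -setCU.
exists [set z | exists x y, [/\ E x, F y & z = x * y]]; congr (~` _).
apply/seteqP; split=> p /=.
  case=> h _ [x [y [Ex Fy ->]]]; rewrite prime_idealrM.
    by rewrite (h x Ex).
  by rewrite (h y Fy) orbT.
move=> h; apply: contrapT => /not_orP[/existsNP[x /not_implyP[Ex /negP nx]]].
move=> /existsNP[y /not_implyP[Fy /negP ny]].
have /h : exists x' y', [/\ E x', F y' & x * y = x' * y'] by exists x, y.
by rewrite prime_idealrM (negPf nx) (negPf ny).
Qed.

Lemma Zariski_open_bigU (I : Type) (f : I -> set Spec) :
  (forall i, Zariski_open (f i)) -> Zariski_open (\bigcup_i f i).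
Proof.
move=> /choice[E fE]; exists (\bigcup_i E i).
rewrite (eq_bigcupr (fun i _ => fE i)) -setC_bigcap; congr (~` _).
apply/seteqP; split=> p /= h; first by move=> x [i _]; apply: h.
by move=> i _ x Ex; apply: h; exists i.
Qed.

HB.instance Definition _ := isOpenTopological.Build Spec
  Zariski_openT Zariski_openI Zariski_open_bigU.

End Spectrum.

Definition minimal_prime (R : comNzRingType) (p : Spec R) : Prop :=
  forall q : Spec R, {subset q <= p} -> {subset p <= q}.

Definition Spec_map (R S : comNzRingType) (f : {rmorphism R -> S}) (p : Spec S)
    : Spec R :=
  MkSpec (comap_idealr_closed f p) (@comap_prime_idealr_closed R S f p).

Module Localization.
Section Localization.
Variables (R : comNzRingType) (P : prime_idealr R).

Definition denom : Type := {s : R | s \notin P}.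
HB.instance Definition _ := Choice.on denom.

Lemma denom1_subproof : 1 \notin P. Proof. by rewrite idealr1. Qed.
Lemma denomM_subproof (s t : denom) : sval s * sval t \notin P.
Proof. by rewrite prime_idealrM negb_or (svalP s) (svalP t). Qed.

Definition denom1 : denom :=
  exist (fun s => s \notin P) 1 denom1_subproof.
Definition denomM (s t : denom) : denom :=
  exist (fun s => s \notin P) _ (denomM_subproof s t).

(* [(a, s)] stands for the fraction a / s. *)
Definition frac : Type := (R * denom)%type.
HB.instance Definition _ := Choice.on frac.

Definition equivl (x y : frac) : bool :=
  `[< exists u : denom,
        sval u * (x.1 * sval y.2) = sval u * (y.1 * sval x.2) >].

Lemma equivlP (x y : frac) :
  reflect (exists u : denom,
        sval u * (x.1 * sval y.2) = sval u * (y.1 * sval x.2)) (equivl x y).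
Proof. exact: asboolP. Qed.

Lemma equivl_refl : reflexive equivl.
Proof. by move=> x; apply/equivlP; exists denom1. Qed.

Lemma equivl_sym : symmetric equivl.
Proof. by move=> x y; apply/equivlP/equivlP => -[u E]; exists u. Qed.

Lemma equivl_trans : transitive equivl.
Proof.
move=> y x z /equivlP[u E] /equivlP[v F]; apply/equivlP.
exists (denomM (denomM u v) y.2) => /=.
transitivity (sval v * sval z.2 * (sval u * (x.1 * sval y.2))); first by ring.
rewrite E; transitivity (sval u * sval x.2 * (sval v * (y.1 * sval z.2))).
  by ring.
by rewrite F; ring.
Qed.

Canonical equivl_equiv := EquivRel equivl equivl_refl equivl_sym equivl_trans.

Definition type : Type := {eq_quot equivl}.
#[export]
HB.instance Definition _ : EqQuotient _ equivl type := EqQuotient.on type.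
#[export]
HB.instance Definition _ := Choice.on type.

Lemma fracP (x y : frac) : \pi_type x = \pi_type y <->
  exists u : denom, sval u * (x.1 * sval y.2) = sval u * (y.1 * sval x.2).
Proof.
split=> [/eqP|h]; first by rewrite piE => /equivlP.
by apply/eqP; rewrite piE; apply/equivlP.
Qed.

Definition zerof : frac := (0, denom1).
Definition onef : frac := (1, denom1).
Definition oppf (x : frac) : frac := (- x.1, x.2).
Definition addf (x y : frac) : frac :=
  (x.1 * sval y.2 + y.1 * sval x.2, denomM x.2 y.2).
Definition mulf (x y : frac) : frac := (x.1 * y.1, denomM x.2 y.2).

Definition zero : type := \pi_type zerof.
Definition one : type := \pi_type onef.
Definition opp (x : type) : type := \pi_type (oppf (repr x)).
Definition add (x y : type) : type := \pi_type (addf (repr x) (repr y)).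
Definition mul (x y : type) : type := \pi_type (mulf (repr x) (repr y)).

Lemma type_ind (Q : type -> Prop) :
  (forall x : frac, Q (\pi_type x)) -> forall x, Q x.
Proof. by move=> h x; rewrite -[x]reprK. Qed.

Lemma repr_frac (x : frac) : exists u : denom,
  sval u * ((repr (\pi_type x)).1 * sval x.2) =
  sval u * (x.1 * sval (repr (\pi_type x)).2).
Proof. by apply/fracP; rewrite reprK. Qed.

Lemma pi_opp (x : frac) : opp (\pi_type x) = \pi_type (oppf x).
Proof.
by have [u E] := repr_frac x; apply/fracP; exists u; rewrite /= !mulNr !mulrN E.
Qed.

Lemma pi_add (x y : frac) :
  add (\pi_type x) (\pi_type y) = \pi_type (addf x y).
Proof.
have [u E] := repr_frac x; have [v F] := repr_frac y.
apply/fracP; exists (denomM u v) => /=.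
move: E F; set x' := repr (\pi_type x); set y' := repr (\pi_type y) => E F.
transitivity (sval v * (sval y'.2 * sval y.2) * (sval u * (x'.1 * sval x.2)) +
  sval u * (sval x'.2 * sval x.2) * (sval v * (y'.1 * sval y.2))); first by ring.
by rewrite E F; ring.
Qed.

Lemma pi_mul (x y : frac) :
  mul (\pi_type x) (\pi_type y) = \pi_type (mulf x y).
Proof.
have [u E] := repr_frac x; have [v F] := repr_frac y.
apply/fracP; exists (denomM u v) => /=.
move: E F; set x' := repr (\pi_type x); set y' := repr (\pi_type y) => E F.
transitivity ((sval u * (x'.1 * sval x.2)) * (sval v * (y'.1 * sval y.2))).
  by ring.
by rewrite E F; ring.
Qed.

Local Ltac frac_eq := apply/fracP; exists denom1 => /=; ring.

Lemma addA : associative add.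
Proof.
elim/type_ind=> x; elim/type_ind=> y; elim/type_ind=> z; rewrite !pi_add; frac_eq.
Qed.

Lemma addC : commutative add.
Proof. elim/type_ind=> x; elim/type_ind=> y; rewrite !pi_add; frac_eq. Qed.

Lemma add0 : left_id zero add.
Proof. elim/type_ind=> x; rewrite pi_add; frac_eq. Qed.

Lemma addN : left_inverse zero opp add.
Proof. elim/type_ind=> x; rewrite pi_opp pi_add; frac_eq. Qed.

Lemma mulA : associative mul.
Proof.
elim/type_ind=> x; elim/type_ind=> y; elim/type_ind=> z; rewrite !pi_mul; frac_eq.
Qed.

Lemma mulC : commutative mul.
Proof. elim/type_ind=> x; elim/type_ind=> y; rewrite !pi_mul; frac_eq. Qed.

Lemma mul1 : left_id one mul.
Proof. elim/type_ind=> x; rewrite pi_mul; frac_eq. Qed.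

Lemma mulDl : left_distributive mul add.
Proof.
elim/type_ind=> x; elim/type_ind=> y; elim/type_ind=> z; rewrite !(pi_add, pi_mul); frac_eq.
Qed.

#[export]
HB.instance Definition _ := GRing.isZmodule.Build type addA addC add0 addN.

Lemma one_neq0 : one != 0.
Proof.
apply/eqP => /fracP[u]; rewrite /= !mul0r !mulr1 mulr0 => u0.
by have := svalP u; rewrite u0 idealr0.
Qed.

#[export]
HB.instance Definition _ :=
  GRing.Zmodule_isComNzRing.Build type mulA mulC mul1 mulDl one_neq0.

End Localization.

Module Exports. HB.reexport. End Exports.
End Localization.

Export Localization.Exports.

(* The local ring R_P of fractions a / s with s outside P. *)
Definition localization (R : comNzRingType) (P : prime_idealr R)
  : comNzRingType := Localization.type P.

Section TRing.
Variables (A : comNzRingType) (m : idealr A).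

Definition residue_ring : comNzRingType := {ideal_quot m}.

Definition residue (a : A) : residue_ring := \pi_({ideal_quot m}) a.

Definition T_pred : {pred A * (nat -> residue_ring)} :=
  fun x => `[< finite_set [set i | x.2 i <> residue x.1] >].

Lemma T_predP (x : A * (nat -> residue_ring)) :
  reflect (finite_set [set i | x.2 i <> residue x.1]) (x \in T_pred).
Proof. exact: asboolP. Qed.

Lemma T_subring_closed : subring_closed T_pred.
Proof.
split=> [|x y /T_predP fx /T_predP fy|x y /T_predP fx /T_predP fy].
- apply/T_predP; rewrite (_ : [set _ | _] = set0) //.
  apply/seteqP; split=> i //=; apply.
  by rewrite /residue pi_oner.
- apply/T_predP; apply: (@sub_finite_set _ _ (_ `|` _)); last first.
    by rewrite finite_setU; split; [exact: fx|exact: fy].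
  move=> i /= h; apply: contrapT => /not_orP[/contrapT ex /contrapT ey].
  apply: h; transitivity (x.2 i - y.2 i) => //.
  by rewrite ex ey; apply/esym; apply: (rmorphB \pi_({ideal_quot m})).
- apply/T_predP; apply: (@sub_finite_set _ _ (_ `|` _)); last first.
    by rewrite finite_setU; split; [exact: fx|exact: fy].
  move=> i /= h; apply: contrapT => /not_orP[/contrapT ex /contrapT ey].
  apply: h; transitivity (x.2 i * y.2 i) => //.
  by rewrite ex ey; apply/esym; apply: (rmorphM \pi_({ideal_quot m})).
Qed.

HB.instance Definition _ := GRing.isSubringClosed.Build
  (A * (nat -> residue_ring))%type T_pred T_subring_closed.

(* The index set {1, 2, ...} is represented by [nat]. *)
Record T := MkT { T_val :> A * (nat -> residue_ring); _ : T_val \in T_pred }.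

HB.instance Definition _ := [isSub for T_val].
HB.instance Definition _ := [Choice of T by <:].
HB.instance Definition _ := [SubChoice_isSubComNzRing of T by <:].

Definition T_proj (x : T) : A := (T_val x).1.

Lemma T_proj_zmod : zmod_morphism T_proj. Proof. by []. Qed.
Lemma T_proj_monoid : monoid_morphism T_proj. Proof. by []. Qed.
HB.instance Definition _ := GRing.isZmodMorphism.Build T A T_proj T_proj_zmod.
HB.instance Definition _ :=
  GRing.isMonoidMorphism.Build T A T_proj T_proj_monoid.

Definition T_J : set T := [set x | T_proj x = 0].

Definition T_M (i : nat) : {pred T} := fun x => (T_val x).2 i == 0.

Lemma T_M_idealr_closed i : idealr_closed (T_M i).
Proof.
split=> [||a x y]; rewrite !unfold_in /=.
- exact: eqxx.
- exact: oner_neq0.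
move=> /eqP x0 /eqP y0; apply/eqP.
transitivity ((T_val a).2 i * (T_val x).2 i + (T_val y).2 i) => //.
by rewrite x0 y0 mulr0 addr0.
Qed.

HB.instance Definition _ i := isIdealr.Build T (T_M i) (T_M_idealr_closed i).

Definition T_P (p : Spec A) : Spec T := Spec_map T_proj p.

Definition T_Minf : idealr T := comap T_proj m : idealr T.

End TRing.

Arguments T_proj {A} m x.
Arguments T_J {A} m.
Arguments T_M {A} m i.
Arguments T_P {A} m p.

(* Main.v *)
Require Import Defs.
From HB Require Import structures.
From mathcomp Require Import all_boot all_order all_algebra.
From mathcomp Require Import generic_quotient ring_quotient.
From mathcomp Require Import boolp classical_sets functions cardinality filter.
From mathcomp Require Import topology.
From mathcomp Require Import ring.

Set Implicit Arguments.
Unset Strict Implicit.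
Unset Printing Implicit Defensive.

Import GRing.Theory.

Local Open Scope classical_set_scope.
Local Open Scope ring_scope.

(* Let e_i be the idempotent (0, delta_i).  An element x of J has finite support
   s, so it is killed by the product of the 1 - e_i, i in s, which pi maps to 1.
   Hence a prime Q that does not contain J contains some 1 - e_i, so it misses
   e_i; as e_i M_i = 0, it contains M_i, and Q = M_i because M_i, the kernel of a
   surjection onto kappa, is maximal.  In particular {M_i} is the basic open set
   D(e_i).  The same two annihilators compute the localizations, and the constant
   section a |-> (a, (abar)) of pi gives the inverse of p |-> P_p. *)

(** * Maximal ideals: inverses modulo an ideal, primality, preimages under surjections *)

Section MaximalIdeals.
Variable R : comNzRingType.
Implicit Types I : idealr R.

(** The ideal I + (x), kept as a bare predicate because an [idealr] is proper and this sum may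
    contain 1. *)
Definition adjoin I (x : R) : {pred R} :=
  fun z => `[< exists y, z - x * y \in I >].

Lemma mem_adjoin I x z : z \in adjoin I x <-> exists y, z - x * y \in I.
Proof. by split=> [/asboolP|h]; last exact/asboolP. Qed.

Lemma adjoin_idealr_closed I x : 1 \notin adjoin I x ->
  idealr_closed (adjoin I x).
Proof.
move=> I1; split=> // [|a u v /mem_adjoin[y uy] /mem_adjoin[z vz]].
  by apply/mem_adjoin; exists 0; rewrite mulr0 subr0 idealr0.
apply/mem_adjoin; exists (a * y + z).
rewrite (_ : _ - _ = a * (u - x * y) + (v - x * z)); last by ring.
by rewrite rpredD ?idealMr.
Qed.

(** If x had no inverse modulo I, then I + (x) would be a proper ideal containing x, against
    maximality. Conversely, an element of K outside I has an inverse modulo I, which forces 1 into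
    K. *)
Lemma maximal_idealP I :
  maximal_ideal I <-> forall x, x \notin I -> exists y, 1 - x * y \in I.
Proof.
split=> [maxI x xI|invI K IK x xK].
  apply/mem_adjoin; apply: contraNT xI => /adjoin_idealr_closed Kid.
  pose K : idealr R := HB.pack (adjoin I x) (isIdealr.Build R (adjoin I x) Kid).
  apply: (maxI K) => [z zI|]; apply/mem_adjoin.
    by exists 0; rewrite mulr0 subr0.
  by exists 1; rewrite mulr1 subrr idealr0.
apply: contraFT (idealr1 K) => /invI[y /IK yK].
by rewrite -(subrK (x * y) 1) rpredD // mulrC idealMr.
Qed.

Lemma maximal_ideal_prime I : maximal_ideal I -> prime_idealr_closed I.
Proof.
move=> /maximal_idealP maxI u v uvI; case: (boolP (u \in I)) => //=.
move=> /maxI[y yI]; rewrite (_ : v = v * (1 - u * y) + y * (u * v)); last by ring.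
by apply: rpredD; [exact: idealMr|apply: idealMr; exact: uvI].
Qed.

End MaximalIdeals.

Lemma eq_maximal_ideal (R : comNzRingType) (I K : idealr R) :
  I =i K -> maximal_ideal I -> maximal_ideal K.
Proof.
move=> IK /maximal_idealP maxI; apply/maximal_idealP => x.
by rewrite -IK => /maxI[y]; exists y; rewrite -IK.
Qed.

Section ComapSurjective.
Variables (R S : comNzRingType) (f : {rmorphism R -> S}).
Hypothesis f_surj : forall y, exists x, f x = y.

Lemma comap_maximal_ideal (I : idealr S) :
  maximal_ideal (comap f I) <-> maximal_ideal I.
Proof.
split=> /maximal_idealP maxI; apply/maximal_idealP => x.
  have [z <-] := f_surj x; rewrite -mem_comap => /maxI[y].
  by rewrite mem_comap rmorphB rmorphM rmorph1; exists (f y).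
rewrite mem_comap => /maxI[y]; have [z <-] := f_surj y.
by exists z; rewrite mem_comap rmorphB rmorphM rmorph1.
Qed.

End ComapSurjective.

(** * Zariski topology: maps induced on spectra, closed sets *)

Lemma Spec_map_continuous (R S : comNzRingType) (f : {rmorphism R -> S}) :
  continuous (Spec_map f).
Proof.
(* The preimage of p contains E exactly when p contains f(E). *)
apply/continuousP => _ [E ->]; exists (f @` E).
apply/seteqP; split=> p /= np h; apply: np.
  by move=> x Ex; apply: (h (f x)); exists x.
by move=> _ [x Ex <-]; exact: (h x Ex).
Qed.

Lemma closed_zero_locus (R : comNzRingType) (E : set R) : closed (zero_locus E).
Proof. by rewrite -[zero_locus E]setCK; apply: open_closedC; exists E. Qed.

(** * The canonical map to a localization, and a criterion for recognising localizations *)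

Section LocalizationMap.
Local Open Scope quotient_scope.
Variables (R : comNzRingType) (P : prime_idealr R).

Definition to_localization (a : R) : localization P :=
  \pi_(Localization.type P) (a, Localization.denom1 P).

Lemma to_localization_zmod : zmod_morphism to_localization.
Proof.
move=> a b; rewrite /to_localization.
transitivity (Localization.add (\pi_(Localization.type P) (a, Localization.denom1 P))
  (Localization.opp (\pi_(Localization.type P) (b, Localization.denom1 P)))) => //.
rewrite Localization.pi_opp Localization.pi_add.
by apply/Localization.fracP; exists (Localization.denom1 P) => /=; ring.
Qed.

Lemma to_localization_monoid : monoid_morphism to_localization.
Proof.
split=> // a b.
transitivity (Localization.mul (to_localization a) (to_localization b)) => //.
rewrite Localization.pi_mul.
by apply/Localization.fracP; exists (Localization.denom1 P) => /=; ring.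
Qed.

HB.instance Definition _ :=
  GRing.isZmodMorphism.Build R (localization P) to_localization
    to_localization_zmod.
HB.instance Definition _ :=
  GRing.isMonoidMorphism.Build R (localization P) to_localization
    to_localization_monoid.

Lemma localization_mulE (x y : localization P) : x * y = Localization.mul x y.
Proof. by []. Qed.

Lemma to_localization_inv (s : R) : s \notin P ->
  exists t, to_localization s * t = 1.
Proof.
move=> sP; exists (\pi_(Localization.type P) (1, exist _ s sP : Localization.denom P)).
rewrite localization_mulE Localization.pi_mul.
by apply/Localization.fracP; exists (Localization.denom1 P) => /=; ring.
Qed.

Lemma to_localization_frac (y : localization P) :
  exists a s, s \notin P /\ y * to_localization s = to_localization a.
Proof.
elim/Localization.type_ind: y => -[a [s sP]]; exists a, s; split=> //.
rewrite localization_mulE Localization.pi_mul.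
by apply/Localization.fracP; exists (Localization.denom1 P) => /=; ring.
Qed.

Lemma to_localization_eq0 (a : R) : to_localization a = 0 ->
  exists2 u, u \notin P & u * a = 0.
Proof.
move=> /Localization.fracP[[u uP]] /= h; exists u => //.
by rewrite mulr1 mul0r mulr0 in h.
Qed.

(** Units for denominators make a/s |-> f(a)/f(s) well defined, writing every y as a fraction makes
    it surjective, and a denominator killing each element of the kernel makes it injective. The
    three preceding lemmas are these conditions for the canonical map. *)
Lemma localization_ring_iso (S : comNzRingType) (f : {rmorphism R -> S}) :
  (forall s, s \notin P -> exists t, f s * t = 1) ->
  (forall y, exists a s, s \notin P /\ y * f s = f a) ->
  (forall a, f a = 0 -> exists2 u, u \notin P & u * a = 0) ->
  ring_iso (localization P) S.
Proof.
move=> f_unit f_surj f_ker.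
have /choice[inv invP] (s : Localization.denom P) : exists t, f (sval s) * t = 1.
  exact: f_unit (svalP s).
have invI (s : Localization.denom P) : injective ( *%R (f (sval s))).
  by move=> x y /(congr1 ( *%R (inv s))); rewrite !mulrA [inv s * _]mulrC invP !mul1r.
(* [g] is computed on chosen representatives; [gE] frees it from that choice, and every identity
   about [g] then follows by cancelling images of denominators with [invI]. *)
pose g (x : localization P) := f (repr x).1 * inv (repr x).2.
have gE x : f (sval x.2) * g (\pi_(Localization.type P) x) = f x.1.
  have [u E] := Localization.repr_frac x; rewrite /g.
  move: (repr _) E => y E; apply: (invI u); apply: (invI y.2).
  transitivity (f (sval u) * (f y.1 * f (sval x.2)) * (f (sval y.2) * inv y.2)).
    by ring.
  by rewrite invP -!rmorphM E !rmorphM; ring.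
have gD : zmod_morphism g.
  elim/Localization.type_ind=> x; elim/Localization.type_ind=> y.
  have -> : \pi_(Localization.type P) x - \pi_(Localization.type P) y
      = \pi_(Localization.type P) (Localization.addf x (Localization.oppf y)) :> localization P.
    by rewrite -Localization.pi_add -Localization.pi_opp.
  apply: (invI (Localization.denomM x.2 y.2)).
  apply: etrans (gE (Localization.addf x (Localization.oppf y))) _.
  rewrite /= !rmorphD !rmorphM rmorphN -!gE; ring.
have gM : monoid_morphism g.
  split.
    by have /= := gE (Localization.onef P); rewrite rmorph1 mul1r.
  elim/Localization.type_ind=> x; elim/Localization.type_ind=> y.
  rewrite localization_mulE Localization.pi_mul.
  apply: (invI (Localization.denomM x.2 y.2)).
  apply: etrans (gE (Localization.mulf x y)) _; rewrite /= !rmorphM -!gE; ring.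
pose G : {rmorphism localization P -> S} := HB.pack g
  (GRing.isZmodMorphism.Build _ _ g gD) (GRing.isMonoidMorphism.Build _ _ g gM).
have G_inj : injective G.
  apply: raddf_inj; elim/Localization.type_ind=> x Gx0.
  have := gE x; rewrite [g _]Gx0 mulr0 => /esym/f_ker[u uP ux].
  apply/Localization.fracP; exists (exist _ u uP : Localization.denom P).
  by rewrite /= mulrA ux !mul0r mulr0.
have /choice[h hK] y : exists x, G x = y.
  have [a [s [sP E]]] := f_surj y.
  pose s' : Localization.denom P := exist _ s sP.
  exists (\pi_(Localization.type P) (a, s')); apply: (invI s').
  by rewrite (gE (a, s')) -E mulrC.
by exists G; exists h => // x; apply: G_inj.
Qed.

End LocalizationMap.

(** * The ring T(A): residue map, coordinates, constant section, idempotents *)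

Section TRing.
Local Open Scope quotient_scope.
Variables (A : comNzRingType) (m : idealr A).

Lemma residue_zmod : zmod_morphism (residue m).
Proof. exact: (rmorphB \pi_({ideal_quot m})). Qed.

Lemma residue_monoid : monoid_morphism (residue m).
Proof.
by split; [exact: (rmorph1 \pi_({ideal_quot m}))|exact: (rmorphM \pi_({ideal_quot m}))].
Qed.

HB.instance Definition _ :=
  GRing.isZmodMorphism.Build A (residue_ring m) (residue m) residue_zmod.
HB.instance Definition _ :=
  GRing.isMonoidMorphism.Build A (residue_ring m) (residue m) residue_monoid.

Lemma residue_surj (c : residue_ring m) : exists a, residue m a = c.
Proof. by exists (repr c); rewrite /residue reprK. Qed.

Lemma residue_eq0 a : (residue m a == 0) = (a \in m).
Proof. by rewrite -[in RHS](subr0 a) Quotient.idealrBE -[\pi_(_) 0]/(residue m 0) rmorph0. Qed.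

Definition T_coord (i : nat) (x : T m) : residue_ring m := (T_val x).2 i.

Lemma T_coord_zmod i : zmod_morphism (T_coord i). Proof. by []. Qed.
Lemma T_coord_monoid i : monoid_morphism (T_coord i). Proof. by []. Qed.
HB.instance Definition _ i := GRing.isZmodMorphism.Build (T m) (residue_ring m)
  (T_coord i) (T_coord_zmod i).
HB.instance Definition _ i := GRing.isMonoidMorphism.Build (T m) (residue_ring m)
  (T_coord i) (T_coord_monoid i).

Lemma mem_T_M i x : (x \in T_M m i) = (T_coord i x == 0).
Proof. by []. Qed.

Lemma T_ext (x y : T m) : T_proj m x = T_proj m y ->
  (forall i, T_coord i x = T_coord i y) -> x = y.
Proof.
move=> xy1 xy2; apply: val_inj; case: x y xy1 xy2 => [[a c] ?] [[b d] ?] /=.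
by rewrite /T_proj /T_coord /= => -> cd; congr pair; apply/funext.
Qed.

Lemma T_const_subproof a : (a, fun=> residue m a) \in T_pred (m := m).
Proof.
apply/T_predP; rewrite (_ : [set _ | _] = set0) //.
by apply/seteqP; split=> i //=; apply.
Qed.

Definition T_const a : T m := MkT (T_const_subproof a).

Lemma T_const_zmod : zmod_morphism T_const.
Proof. by move=> a b; apply: T_ext => // i; exact: rmorphB. Qed.
Lemma T_const_monoid : monoid_morphism T_const.
Proof. by split=> [|a b]; apply: T_ext => // i; [exact: rmorph1|exact: rmorphM]. Qed.
HB.instance Definition _ :=
  GRing.isZmodMorphism.Build A (T m) T_const T_const_zmod.
HB.instance Definition _ :=
  GRing.isMonoidMorphism.Build A (T m) T_const T_const_monoid.

Lemma T_constK : cancel T_const (T_proj m). Proof. by []. Qed.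

Lemma T_proj_surj a : exists x, T_proj m x = a.
Proof. by exists (T_const a). Qed.

Lemma T_coord_surj i c : exists x, T_coord i x = c.
Proof. by have [a <-] := residue_surj c; exists (T_const a). Qed.

Lemma T_idem_subproof i : (0, fun j => (j == i)%:R) \in T_pred (m := m).
Proof.
apply/T_predP; apply: (@sub_finite_set _ _ [set i]); last exact: finite_set1.
move=> j /= h; apply: contrapT => /eqP ji; apply: h.
by rewrite /= (negPf ji) (rmorph0 (residue m)).
Qed.

Definition T_idem i : T m := MkT (T_idem_subproof i).

Lemma T_proj_idem i : T_proj m (T_idem i) = 0. Proof. by []. Qed.

Lemma T_coord_idem i j : T_coord j (T_idem i) = (j == i)%:R.
Proof. by []. Qed.

Lemma T_idem_notin_M i : T_idem i \notin T_M m i.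
Proof. by rewrite mem_T_M T_coord_idem eqxx oner_eq0. Qed.

Lemma T_idem_mul0 i x : x \in T_M m i -> T_idem i * x = 0.
Proof.
rewrite mem_T_M => /eqP x0; apply: T_ext => [|j].
  by rewrite rmorphM /= T_proj_idem mul0r rmorph0.
rewrite rmorphM /= T_coord_idem rmorph0; have [->|_] := eqVneq j i.
  by rewrite x0 mulr0.
by rewrite mul0r.
Qed.

Lemma T_J_annihilator x : T_J m x ->
  exists s : seq nat, (\prod_(i <- s) (1 - T_idem i)) * x = 0.
Proof.
move=> Jx; have /T_predP := valP x; rewrite [(\val x).1]Jx rmorph0.
(* As the A-component of x is 0, the exceptional set enumerated by [s] is the support of x. *)
move=> /finite_seqP[s sE]; exists s; apply: T_ext => [|j].
  by rewrite rmorphM /= Jx mulr0 rmorph0.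
rewrite rmorphM rmorph0 /=; have [->|/eqP xj] := eqVneq (T_coord j x) 0.
  by rewrite mulr0.
have js : j \in s.
  suff : [set` s] j by [].
  by rewrite -sE.
(* The factor 1 - e_j has j-th coordinate 0. *)
by rewrite (big_rem j) //= rmorphM rmorphB rmorph1 /= T_coord_idem eqxx subrr !mul0r.
Qed.

Lemma T_proj_prod_idem (s : seq nat) :
  T_proj m (\prod_(i <- s) (1 - T_idem i)) = 1.
Proof.
rewrite rmorph_prod big1 // => i _.
by rewrite rmorphB rmorph1 /= T_proj_idem subr0.
Qed.

(** * Primes of T(A) and the closed set V(J) *)

Lemma prime_T_idem (Q : Spec (T m)) i : T_idem i \notin Q ->
  {subset T_M m i <= Q}.
Proof.
move=> iQ x /T_idem_mul0 ix.
by have := idealr0 Q; rewrite -ix prime_idealrM (negPf iQ).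
Qed.

Lemma prime_notin_J (Q : Spec (T m)) :
  ~ zero_locus (T_J m) Q -> exists i, T_idem i \notin Q.
Proof.
move=> /existsNP[x /not_implyP[Jx /negP xQ]].
have [s sx] := T_J_annihilator Jx.
have: \prod_(i <- s) (1 - T_idem i) \in Q.
  by have := idealr0 Q; rewrite -sx prime_idealrM (negPf xQ) orbF.
elim: s {sx} => [|i s IHs]; first by rewrite big_nil idealr1.
rewrite big_cons prime_idealrM => /orP[iQ|//].
(* Having both e_i and 1 - e_i in Q would give 1 in Q. *)
exists i; apply: contraFN (idealr1 Q) => jQ.
by rewrite -(subrK (T_idem i) 1) rpredD.
Qed.

Lemma mem_T_P (p : Spec A) x : (x \in T_P m p) = (T_proj m x \in p).
Proof. by []. Qed.

Lemma range_T_P : range (T_P m) = zero_locus (T_J m).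
Proof.
apply/seteqP; split=> [_ [p _ <-] x Jx|Q JQ].
  by rewrite mem_T_P Jx idealr0.
(* Contract Q along the constant section: x and the constant lift of pi(x) differ by an element of
   J, hence of Q. *)
exists (Spec_map T_const Q) => //; apply/Spec_eqP => x.
rewrite !mem_comap -[in RHS](subrK (T_const (T_proj m x)) x) rpredDl //.
by apply: JQ; rewrite /T_J /= rmorphB /= T_constK subrr.
Qed.

Lemma T_P_homeomorphism : homeomorphism_onto (T_P m) (zero_locus (T_J m)).
Proof.
have gK : cancel (T_P m) (Spec_map T_const).
  by move=> p; apply/Spec_eqP.
split; last first.
(* The inverse is induced by a ring map, so it is continuous on all of Spec T(A) and restricts to
   V(J). *)
- exists (Spec_map T_const) => //; apply: continuous_subspaceT.
  exact: Spec_map_continuous.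
- exact: Spec_map_continuous.
rewrite -range_T_P; apply: inj_bij => p q _ _; exact: (@can_inj _ _ _ _ gK p q).
Qed.

(** * For m maximal: the points M_i, the localizations, the maximal ideals *)

Section MaximalT.
Hypothesis m_max : maximal_ideal m.

Lemma residue_inv (c : residue_ring m) : c != 0 -> exists d, c * d = 1.
Proof.
have [a <-] := residue_surj c; rewrite residue_eq0.
have /maximal_idealP h := m_max.
move=> /h[b]; rewrite -residue_eq0 rmorphB rmorph1 rmorphM subr_eq0 => /eqP ab.
by exists (residue m b).
Qed.

Lemma T_M_maximal i : maximal_ideal (T_M m i).
Proof.
apply/maximal_idealP => x; rewrite mem_T_M => /residue_inv[d xd].
have [y yd] := T_coord_surj i d; exists y.
by rewrite mem_T_M rmorphB rmorph1 rmorphM /= yd xd subrr.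
Qed.

Definition T_MS i : Spec (T m) :=
  MkSpec (T_M_idealr_closed m i) (maximal_ideal_prime (@T_M_maximal i)).

(** Q contains M_i, which is maximal. Minimality, isolation and the covering of the spectrum all
    rest on this. *)
Lemma T_MS_eq (Q : Spec (T m)) i : T_idem i \notin Q -> Q = T_MS i.
Proof.
move=> iQ; have MQ := prime_T_idem iQ; apply/Spec_eqP => x.
by apply/idP/idP; [exact: (T_M_maximal MQ)|exact: MQ].
Qed.

Lemma T_MS_minimal i : minimal_prime (T_MS i).
Proof.
move=> Q QM; have iQ : T_idem i \notin Q.
  exact: contra (QM (T_idem i)) (T_idem_notin_M i).
by rewrite -(T_MS_eq iQ).
Qed.

Lemma T_MS_isolated i : isolated [set: Spec (T m)] (T_MS i).
Proof.
split; first exact: in_setT.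
exists (~` zero_locus [set T_idem i]).
  apply: open_nbhs_nbhs; split; first by exists [set T_idem i].
  by move=> /(_ _ erefl); apply/negP/T_idem_notin_M.
rewrite setIT; apply/seteqP; split=> [Q h|_ ->] /=.
  by apply: T_MS_eq; apply/negP => iQ; apply: h => _ ->.
by move=> /(_ _ erefl); apply/negP/T_idem_notin_M.
Qed.

Lemma Spec_T_cover : range (T_P m) `|` range T_MS = [set: Spec (T m)].
Proof.
rewrite range_T_P; apply/seteqP; split=> // Q _.
have [JQ|/prime_notin_J[i /T_MS_eq ->]] := pselect (zero_locus (T_J m) Q).
  by left.
by right; exists i.
Qed.

Lemma Spec_T_disjoint : range (T_P m) `&` range T_MS = set0.
Proof.
rewrite range_T_P -subset0 => Q [h [i _ ME]]; rewrite -ME in h.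
(* e_i lies in J but not in M_i, so M_i does not contain J. *)
exact: (negP (T_idem_notin_M i)) (h (T_idem i) (T_proj_idem i)).
Qed.

Lemma localization_T_P (p : Spec A) :
  ring_iso (localization (T_P m p)) (localization p).
Proof.
apply: (localization_ring_iso
  (f := [the {rmorphism _ -> _} of to_localization p \o T_proj m])) => /=.
- by move=> s; rewrite mem_T_P; exact: to_localization_inv.
- move=> y; have [a [s [sp E]]] := to_localization_frac y.
  by exists (T_const a), (T_const s); split.
move=> x /to_localization_eq0[u up ux].
(* Since u kills pi(x), the product of x with the constant lift of u lies in J. The annihilator of x
   is thus a product of factors 1 - e_i times that lift; pi sends it to u, so it lies outside
   P_p. *)
have [s sx] : exists s : seq nat,
    (\prod_(i <- s) (1 - T_idem i)) * (T_const u * x) = 0.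
  by apply: T_J_annihilator; rewrite /T_J /= rmorphM.
exists (\prod_(i <- s) (1 - T_idem i) * T_const u); last by rewrite -mulrA.
by rewrite mem_T_P rmorphM /= T_proj_prod_idem mul1r.
Qed.

Lemma localization_T_MS i : ring_iso (localization (T_MS i)) (residue_ring m).
Proof.
apply: (localization_ring_iso (f := T_coord i)).
- by move=> s; rewrite mem_T_M; exact: residue_inv.
(* The coordinate map is already surjective, so denominator 1 suffices. *)
- move=> y; have [x <-] := T_coord_surj i y; exists x, 1.
  by rewrite idealr1 rmorph1 mulr1.
move=> x /eqP x0; exists (T_idem i); first exact: T_idem_notin_M.
exact: T_idem_mul0.
Qed.

Lemma maximal_idealT (I : idealr (T m)) :
  (forall n : idealr A, maximal_ideal n -> n =i m) ->
  maximal_ideal I <-> I =i T_Minf m \/ exists i, I =i T_M m i.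
Proof.
move=> m_uniq; split=> [I_max|[IM|[i IM]]]; last 2 first.
- apply: (@eq_maximal_ideal _ (T_Minf m)) => //.
  by apply/comap_maximal_ideal; [exact: T_proj_surj|].
- by apply: (@eq_maximal_ideal _ (T_M m i)) => //; exact: T_M_maximal.
have I_id : idealr_closed I.
  split; rewrite ?idealr0 ?idealr1 // => a u v uI vI.
  by rewrite rpredD ?idealMr.
pose Q : Spec (T m) := MkSpec I_id (maximal_ideal_prime I_max).
have QI : Q =i I by [].
have := in_setT Q; rewrite -Spec_T_cover inE => -[][p _ pQ].
  (* Here I = P_p, and maximality passes to p along the surjection pi, so p = m because A has only
     one maximal ideal. *)
  left=> x; rewrite -QI -pQ mem_T_P; apply: m_uniq.
  apply/(comap_maximal_ideal T_proj_surj).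
  by apply: (@eq_maximal_ideal _ I) => // y; rewrite -QI -pQ.
by right; exists p => x; rewrite -QI -pQ.
Qed.

End MaximalT.
End TRing.

Theorem theorem4p1 (A : comNzRingType) (m : idealr A) (Am : local_ring m) :
  exists M : nat -> Spec (T m),
    (forall i, M i =i T_M m i) /\
    (* the primes of T m, as a disjoint union *)
    (range (T_P m) `|` range M = [set: Spec (T m)] /\
     range (T_P m) `&` range M = set0) /\
    (* the first family *)
    (range (T_P m) = zero_locus (T_J m) /\
     closed (zero_locus (T_J m)) /\
     homeomorphism_onto (T_P m) (zero_locus (T_J m))) /\
    (* the second family *)
    (forall i, minimal_prime (M i) /\ maximal_ideal (M i) /\
               isolated [set: Spec (T m)] (M i)) /\
    (* the localizations *)
    (forall p : Spec A, ring_iso (localization (T_P m p)) (localization p)) /\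
    (forall i, ring_iso (localization (M i)) (residue_ring m)) /\
    (* the maximal ideals *)
    (forall I : idealr (T m),
       maximal_ideal I <-> I =i T_Minf m \/ exists i, I =i T_M m i).
Proof.
have [m_max m_uniq] := Am; exists (T_MS m_max); split=> //.
split; first by split; [exact: Spec_T_cover|exact: Spec_T_disjoint].
split.
  split; first exact: range_T_P.
  by split; [exact: closed_zero_locus|exact: T_P_homeomorphism].
split.
  move=> i; split; first exact: T_MS_minimal.
  by split; [exact: T_M_maximal|exact: T_MS_isolated].
split; first exact: localization_T_P.
split; first exact: localization_T_MS.
by move=> I; exact: maximal_idealT.
Qed.
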